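(* Let $E'\subset E$. The following statements are equivalent. (1) $\operatorname{Ap}(\mathcal S,E')$ has a maximal element with respect to $\preceq_{\mathcal S}$. (2) There exists $\mathbf b\in\operatorname{Ap}(\mathcal S,E')$ such that $\mathbf b+\mathbf a_i\notin\operatorname{Ap}(\mathcal S,E')$ for every $\mathbf a_i\in E\setminus E'$.
   Context: $\mathcal S$ is a simplicial affine semigroup, i.e. the submonoid of $\mathbb N^d$ generated by a finite minimal generating set $\mathcal A=\{\mathbf a_1,\dots,\mathbf a_e\}\subset\mathbb N^d$, where the subgroup $\mathbb Z\mathcal A\subseteq\mathbb Z^d$ has rank $d$ and $E=\{\mathbf a_1,\dots,\mathbf a_d\}$ is $\mathbb Q$-linearly independent and generates the rational cone $\operatorname{pos}(\mathcal A)=\{\sum_{i=1}^e q_i\mathbf a_i : q_i\in\mathbb Q_{\ge0}\}$; each $\mathbf a_i$ with $1\le i\le d$ is the componentwise smallest element of $\mathcal A$ lying on its extremal ray of $\operatorname{pos}(\mathcal A)$. For a finite subset $\mathcal B\subseteq\mathcal S$, $\operatorname{Ap}(\mathcal S,\mathcal B)=\{\mathbf a\in\mathcal S : \mathbf a-\mathbf b\notin\mathcal S\text{ for all }\mathbf b\in\mathcal B\}$. The partial order $\preceq_{\mathcal S}$ on $\mathcal S$ is defined by $\mathbf a\preceq_{\mathcal S}\mathbf a'$ iff $\mathbf a'-\mathbf a\in\mathcal S$. *)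

(* Defs.v *)
From HB Require Import structures.
From mathcomp Require Import all_boot all_order all_algebra.
From mathcomp Require Import classical_sets.

Set Implicit Arguments.
Unset Strict Implicit.
Unset Printing Implicit Defensive.

Import Order.TTheory GRing.Theory Num.Theory.
Local Open Scope classical_set_scope.
Local Open Scope ring_scope.

(* All vectors live in Z^d, so that differences are genuine differences;
   membership in N^d is the field [sas_nat] of [simplicial_affine]. *)

Definition submonoid_closed (V : nmodType) (M : set V) : Prop :=
  M 0 /\ (forall x y, M x -> M y -> M (x + y)).

Definition subgroup_closed (V : zmodType) (G : set V) : Prop :=
  G 0 /\ (forall x y, G x -> G y -> G (x - y)).

Definition submonoid_gen (V : nmodType) (B : set V) : set V :=
  smallest (@submonoid_closed V) B.

Definition subgroup_gen (V : zmodType) (B : set V) : set V :=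
  smallest (@subgroup_closed V) B.

Definition minimal_generating (V : nmodType) (B : set V) : Prop :=
  forall C : set V,
    C `<=` B -> submonoid_gen C = submonoid_gen B -> C = B.

Definition Zindependent (V : zmodType) (r : nat) (v : 'I_r -> V) : Prop :=
  forall c : 'I_r -> int, \sum_(i < r) v i *~ c i = 0 -> forall i, c i = 0.

(* The rank of an abelian group is the largest size of a Z-independent family
   of its elements. *)
Definition has_rank (V : zmodType) (G : set V) (r : nat) : Prop :=
  (exists v : 'I_r -> V, (forall i, G (v i)) /\ Zindependent v) /\
  (forall (m : nat) (v : 'I_m -> V),
     (forall i, G (v i)) -> Zindependent v -> (m <= r)%N).

Definition toQ (d : nat) (x : 'rV[int]_d) : 'rV[rat]_d :=
  map_mx (intr : int -> rat) x.

Definition pos (d n : nat) (v : 'I_n -> 'rV[int]_d) : set 'rV[rat]_d :=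
  [set x | exists q : 'I_n -> rat,
     (forall i, 0 <= q i) /\ x = \sum_(i < n) q i *: toQ (v i)].

Definition ray (d : nat) (x : 'rV[rat]_d) : set 'rV[rat]_d :=
  [set y | exists q : rat, 0 <= q /\ y = q *: x].

Definition extremal_ray (d : nat) (C R : set 'rV[rat]_d) : Prop :=
  (exists x, x != 0 /\ R = ray x) /\ R `<=` C /\
  (forall x y, C x -> C y -> R (x + y) -> R x /\ R y).

Definition le_comp (d : nat) (x y : 'rV[int]_d) : Prop :=
  forall j, x 0 j <= y 0 j.

(* The generators are a_1, ..., a_e with e = d + k, and a_1, ..., a_d are
   those indexed by [lshift k i] for i : 'I_d. *)
Definition ext_gen (d k : nat) (a : 'I_(d + k) -> 'rV[int]_d) (i : 'I_d) :
  'rV[int]_d := a (lshift k i).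

Record simplicial_affine (d k : nat) (a : 'I_(d + k) -> 'rV[int]_d) : Prop :=
  SimplicialAffine {
    sas_nat : forall i j, 0 <= a i 0 j;
    sas_inj : injective a;
    sas_min : minimal_generating (range a);
    sas_rank : has_rank (subgroup_gen (range a)) d;
    sas_free : free [seq toQ (ext_gen a i) | i <- enum 'I_d];
    sas_cone : pos (ext_gen a) = pos a;
    sas_extremal : forall i, extremal_ray (pos a) (ray (toQ (ext_gen a i)));
    sas_least : forall i (j : 'I_(d + k)),
      ray (toQ (ext_gen a i)) (toQ (a j)) -> le_comp (ext_gen a i) (a j)
  }.

Definition Ap (V : zmodType) (S B : set V) : set V :=
  [set x | S x /\ forall b, B b -> ~ S (x - b)].

Definition prec (V : zmodType) (S : set V) (x y : V) : Prop := S (y - x).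

Definition is_maximal (V : Type) (le : V -> V -> Prop) (X : set V) (x : V) :
  Prop := X x /\ forall y, X y -> le x y -> y = x.

(* Main.v *)
Require Import Defs.
From HB Require Import structures.
From mathcomp Require Import all_boot all_order all_algebra.
From mathcomp Require Import boolp classical_sets.

Set Implicit Arguments.
Unset Strict Implicit.
Unset Printing Implicit Defensive.

Import Order.TTheory GRing.Theory Num.Theory.
Local Open Scope classical_set_scope.
Local Open Scope ring_scope.

(** A maximal element [x] can serve as [b] because [x + v] lies strictly above
    [x] for every extremal generator [v], which is nonzero.

    Conversely, let [b] leave [Ap S E'] whenever an element of [E] outside
    [E'] is added to it. Apery sets are closed downwards
    ([Ap_downward]), so no element of [Ap S E'] above [b] is of the form
    [b + v + s] with [v] in [E] and [s] in [S]: for [v] outside [E'] this is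
    the choice of [b], and for [v] in [E'] subtracting [v] stays in [S].
    The cone hypothesis makes every generator [a j] commensurable with [E]:
    some positive multiple of it is a sum of elements of [E]
    ([cone_multiple]). Hence [a j] can be added to [b] only boundedly often
    without leaving [Ap S E'], unless [a j = 0]. So the coordinate sums of
    the elements of [Ap S E'] above [b] are bounded, and one with the largest
    coordinate sum is maximal, the coordinate sum being strictly monotone on
    a submonoid of the positive orthant. *)

Section SubmonoidGen.
Variables (V : nmodType) (B : set V).

Lemma submonoid_gen0 : submonoid_gen B 0.
Proof. by move=> M [[]]. Qed.

Lemma submonoid_genD x y :
  submonoid_gen B x -> submonoid_gen B y -> submonoid_gen B (x + y).
Proof.
move=> Sx Sy M /[dup] MB [[_ MD] _].
by apply: MD; [exact: Sx | exact: Sy].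
Qed.

Lemma submonoid_gen_sub x : B x -> submonoid_gen B x.
Proof. by move=> Bx M [_]; apply. Qed.

Lemma submonoid_genMn x n : submonoid_gen B x -> submonoid_gen B (x *+ n).
Proof.
move=> Sx; elim: n => [|n IHn]; first exact: submonoid_gen0.
by rewrite mulrS; exact: submonoid_genD.
Qed.

Lemma submonoid_gen_sum (I : finType) (P : pred I) (F : I -> V) :
  (forall i, P i -> submonoid_gen B (F i)) ->
  submonoid_gen B (\sum_(i | P i) F i).
Proof.
move=> SF; elim/big_ind: _ => //; first exact: submonoid_gen0.
exact: submonoid_genD.
Qed.

End SubmonoidGen.

Lemma submonoid_gen_rangeP (V : nmodType) (n : nat) (a : 'I_n -> V) (x : V) :
  submonoid_gen (range a) x -> exists c : 'I_n -> nat, x = \sum_i a i *+ c i.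
Proof.
move=> /(_ [set y | exists c : 'I_n -> nat, y = \sum_i a i *+ c i]).
apply; split; first split.
- by exists (fun=> 0%N); rewrite big1.
- move=> _ _ [c ->] [c' ->]; exists (fun i => c i + c' i)%N.
  by rewrite -big_split; apply: eq_bigr => i _; rewrite mulrnDr.
move=> _ [i _ <-]; exists (fun j => (j == i) : nat).
by rewrite (bigD1 i) //= eqxx big1 ?addr0 // => j /negbTE ->.
Qed.

(** If [x - v] were in the semigroup for some [v] in [B], then so would be
    [x + y - v]. *)
Lemma Ap_downward (V : zmodType) (G B : set V) (x y : V) :
  submonoid_gen G x -> submonoid_gen G y ->
  Ap (submonoid_gen G) B (x + y) -> Ap (submonoid_gen G) B x.
Proof.
move=> Sx Sy [_ nS]; split=> // v Bv Sxv; apply: (nS v Bv).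
by rewrite addrAC; exact: submonoid_genD.
Qed.

Lemma common_denominator (n : nat) (q : 'I_n -> rat) :
  (forall i, 0 <= q i) ->
  exists N (m : 'I_n -> nat), (0 < N)%N /\ forall i, q i *+ N = (m i)%:R.
Proof.
move=> q0; pose D i := `|denq (q i)|%N.
exists (\prod_i D i)%N, (fun i => `|numq (q i)| * \prod_(j | j != i) D j)%N.
split=> [|i]; first by rewrite prodn_gt0 // => i; rewrite absz_gt0 denq_eq0.
rewrite (bigD1 i) //= mulrnA natrM -[LHS]mulr_natr; congr (_ * _).
rewrite -[LHS]mulr_natr !natr_absz gtr0_norm ?denq_gt0 //.
by rewrite ger0_norm ?numq_ge0 // -numqE.
Qed.

Lemma toQ_inj (d : nat) : injective (@toQ d).
Proof.
move=> x y /matrixP xy; apply/matrixP => i j.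
by have := xy i j; rewrite !mxE => /intr_inj.
Qed.

Lemma toQ_sumMn (d n : nat) (v : 'I_n -> 'rV[int]_d) (m : 'I_n -> nat) :
  toQ (\sum_i v i *+ m i) = \sum_i toQ (v i) *+ m i.
Proof.
by rewrite /toQ raddf_sum; apply: eq_bigr => i _; rewrite raddfMn.
Qed.

(** Clearing denominators; this is how membership in the rational cone is
    used inside the semigroup. *)
Lemma cone_multiple (d n : nat) (v : 'I_n -> 'rV[int]_d) (x : 'rV[int]_d) :
  pos v (toQ x) ->
  exists N (m : 'I_n -> nat), (0 < N)%N /\ x *+ N = \sum_i v i *+ m i.
Proof.
case=> q [q0 xE]; have [N [m [N0 mE]]] := common_denominator q0.
exists N, m; split=> //; apply: toQ_inj.
rewrite toQ_sumMn /toQ raddfMn /= -!/(toQ _) xE -sumrMnl.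
by apply: eq_bigr => i _; rewrite scalerMnl mE scaler_nat.
Qed.

Lemma pos_gen (d n : nat) (v : 'I_n -> 'rV[int]_d) j : pos v (toQ (v j)).
Proof.
exists (fun i => (i == j)%:R); split=> [i|]; first exact: ler0n.
rewrite (bigD1 j) //= eqxx scale1r big1 ?addr0 // => i /negbTE ->.
by rewrite scale0r.
Qed.

Definition coord_sum (d : nat) (x : 'rV[int]_d) : nat := (\sum_j `|x ord0 j|)%N.

Lemma coord_sumD (d : nat) (x y : 'rV[int]_d) :
  (forall j, 0 <= x 0 j) -> (forall j, 0 <= y 0 j) ->
  coord_sum (x + y) = (coord_sum x + coord_sum y)%N.
Proof.
move=> x0 y0; rewrite /coord_sum -big_split; apply: eq_bigr => j _ /=.
by apply/eqP; rewrite -eqz_nat PoszD mxE !gez0_abs ?addr_ge0.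
Qed.

Lemma coord_sum_eq0 (d : nat) (x : 'rV[int]_d) : coord_sum x = 0%N -> x = 0.
Proof.
move/eqP; rewrite sum_nat_eq0 => /forallP x0.
by apply/rowP => j; rewrite mxE; apply/eqP; rewrite -absz_eq0; exact: x0.
Qed.

Lemma submonoid_gen_ge0 (d : nat) (B : set 'rV[int]_d) :
  (forall x, B x -> forall j, 0 <= x 0 j) ->
  forall x, submonoid_gen B x -> forall j, 0 <= x 0 j.
Proof.
move=> B0 x /(_ [set y | forall j, 0 <= y 0 j]); apply; split=> //=.
split=> [j|y z y0 z0 j]; first by rewrite mxE.
by rewrite mxE addr_ge0.
Qed.

Lemma coord_sum_sum (d n : nat) (F : 'I_n -> 'rV[int]_d) :
  (forall i j, 0 <= F i 0 j) ->
  coord_sum (\sum_i F i) = (\sum_i coord_sum (F i))%N.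
Proof.
move=> F0; rewrite /coord_sum exchange_big; apply: eq_bigr => j _ /=.
apply/eqP; rewrite -eqz_nat summxE gez0_abs ?sumr_ge0 //.
rewrite (big_morph Posz PoszD (erefl _)); apply/eqP/eq_bigr => i _.
by rewrite gez0_abs.
Qed.

Lemma bounded_argmax (T : Type) (X : set T) (f : T -> nat) (M : nat) (x0 : T) :
  X x0 -> (forall x, X x -> (f x <= M)%N) ->
  exists2 x, X x & forall y, X y -> (f y <= f x)%N.
Proof.
move=> Xx0 fM; pose P n := `[< exists2 x, X x & f x = n >].
have exP : exists n, P n by exists (f x0); apply/asboolP; exists x0.
have PM n : P n -> (n <= M)%N by move=> /asboolP[x Xx <-]; exact: fM.
case: (ex_maxnP exP PM) => _ /asboolP[x Xx <-] max; exists x => // y Xy.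
by apply: max; apply/asboolP; exists y.
Qed.

(** A generator can be added to [b] fewer than [N] times, where [N] is such
    that [N] copies of it can be traded for elements of [v]; the zero
    generator is the exception, but it does not change coordinate sums, whence
    the formulation in terms of these. *)
Lemma Ap_multiple_bound (d n : nat) (G B : set 'rV[int]_d)
    (v : 'I_n -> 'rV[int]_d) (b g : 'rV[int]_d) :
  let S := submonoid_gen G in
  (forall i, S (v i)) -> (forall i, ~ Ap S B (b + v i)) ->
  S b -> S g -> pos v (toQ g) ->
  exists M, forall c, Ap S B (b + g *+ c) -> (coord_sum (g *+ c) <= M)%N.
Proof.
move=> S Sv bv Sb Sg /cone_multiple[N [m [N0 gN]]].
have coordMn c : coord_sum (g *+ c) = (c * coord_sum g)%N.
  rewrite /coord_sum big_distrr; apply: eq_bigr => j _ /=.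
  by rewrite mulmxnE -mulr_natl abszM natz absz_nat.
exists (N * coord_sum g)%N => c Apc; rewrite coordMn.
have [/ltnW cN|Nc] := ltnP c N; first by rewrite leq_mul2r cN orbT.
have ApN : Ap S B (b + g *+ N).
  apply: (Ap_downward (y := g *+ (c - N))); rewrite -?addrA -?mulrnDr ?subnKC //.
    by apply: submonoid_genD => //; exact: submonoid_genMn.
  exact: submonoid_genMn.
suff g0 : g = 0 by rewrite g0 /coord_sum big1 ?muln0 // => j _; rewrite mxE.
(* Trading the [N] copies of [g] for elements of [v] puts [b + v i] below
   [b + g *+ N] as soon as [m i] is positive. *)
have m0 i : m i = 0%N.
  case mi: (m i) => [|p] //; case: (bv i).
  apply: (Ap_downward (y := v i *+ p + \sum_(j | j != i) v j *+ m j)).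
  - apply: submonoid_genD; [exact: Sb | exact: Sv].
  - apply: submonoid_genD; first by apply: submonoid_genMn; exact: Sv.
    by apply: submonoid_gen_sum => j _; apply: submonoid_genMn; exact: Sv.
  by move: ApN; rewrite gN (bigD1 i) //= mi mulrS !addrA.
apply: coord_sum_eq0; apply/eqP; rewrite -(eqn_pmul2l N0) muln0 -coordMn gN.
rewrite big1 => [|i _]; last by rewrite m0.
by rewrite /coord_sum big1 // => j _; rewrite mxE.
Qed.

Theorem proposition3p8 (d k : nat) (a : 'I_(d + k) -> 'rV[int]_d)
    (ha : simplicial_affine a)
    (E' : set 'rV[int]_d) (hE' : E' `<=` range (ext_gen a)) :
  let S := submonoid_gen (range a) in
  let E := range (ext_gen a) in
  (exists x, is_maximal (prec S) (Ap S E') x) <->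
  (exists b, Ap S E' b /\ forall v, (E `\` E') v -> ~ Ap S E' (b + v)).
Proof.
move=> S E.
have Sa j : S (a j) by apply: submonoid_gen_sub; exists j.
have S0 : forall x, S x -> forall j, 0 <= x 0 j.
  by apply: submonoid_gen_ge0 => _ [i _ <-]; exact: (sas_nat ha).
split=> [[x [Apx xmax]]|[b [Apb bE]]].
  exists x; split=> // _ [[i _ <-] _] Apxv.
  have xv : x + ext_gen a i = x.
    by apply: xmax => //; rewrite /prec addrC addKr; exact: Sa.
  have v0 : ext_gen a i = 0 by apply: (addrI x); rewrite xv addr0.
  have : toQ (ext_gen a i) \in [seq toQ (ext_gen a i) | i <- enum 'I_d].
    by apply/mapP; exists i; rewrite ?mem_enum.
  by move/(free_not0 (sas_free ha)); rewrite v0 /toQ map_mx0 eqxx.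
have Sb : S b by case: Apb.
(* For an element of [E'] this holds because subtracting it gives [b]. *)
have bv i : ~ Ap S E' (b + ext_gen a i).
  have [E'v|E'v] := pselect (E' (ext_gen a i)); last by apply: bE; split=> //; exists i.
  by case=> _ /(_ _ E'v); rewrite addrK.
have /choice[M Mbound] j : exists M, forall c,
    Ap S E' (b + a j *+ c) -> (coord_sum (a j *+ c) <= M)%N.
  apply: (Ap_multiple_bound (fun i => Sa (lshift k i)) bv Sb (Sa j)).
  by rewrite (sas_cone ha); exact: pos_gen.
have bounded x : Ap S E' x /\ S (x - b) ->
    (coord_sum x <= coord_sum b + \sum_j M j)%N.
  case=> Apx Sxb; have [c xbE] := submonoid_gen_rangeP Sxb.
  have SMn j : S (a j *+ c j) by apply: submonoid_genMn; exact: Sa.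
  rewrite -(subrK b x) addrC coord_sumD ?leq_add2l; [|exact: S0|exact: S0].
  rewrite xbE coord_sum_sum; last by move=> i; exact: S0.
  apply: leq_sum => j _; apply: Mbound.
  apply: (Ap_downward (y := \sum_(i | i != j) a i *+ c i)).
  - by apply: submonoid_genD; [exact: Sb | exact: SMn].
  - by apply: submonoid_gen_sum => i _; exact: SMn.
  suff -> : b + a j *+ c j + \sum_(i | i != j) a i *+ c i = x by [].
  by rewrite -addrA -[_ *+ _ + _](bigD1 j (P := predT)) //= -xbE addrC subrK.
have [|x [Apx Sxb] xmax] := bounded_argmax _ bounded (x0 := b).
  by split=> //; rewrite subrr; exact: submonoid_gen0.
exists x; split=> // y Apy Sxy; apply/eqP; rewrite -subr_eq0; apply/eqP.
apply: coord_sum_eq0.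
have : (coord_sum y <= coord_sum x)%N.
  apply: xmax; split=> //; rewrite -(subrK x y) -addrA.
  exact: submonoid_genD.
rewrite -{1}(subrK x y) addrC coord_sumD; last 2 first.
- by apply: S0; case: Apx.
- exact: S0.
by rewrite -[leqRHS]addn0 leq_add2l leqn0 => /eqP.
Qed.
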